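(* Let $p>1$ be an integer, $a\in\mathbb C$, $h,q\in\mathbb N$, $\boldsymbol d=(d_0,d_1,\dots,d_{p-1})\in\{0,1\}^p$ and let $V$ be a $\mathbb T_{\min\{\boldsymbol d\}}$-module with annihilating level $(h,q)$. Then the $\mathbb T$-module $M_{\mathbb T}(V,a,\boldsymbol d)$ is irreducible if and only if the $\mathbb T_{\min\{\boldsymbol d\}}$-module $V$ is irreducible.
   Context: All vector spaces and algebras are over $\mathbb C$; $\mathbb N$ denotes the non-negative integers; the convention $0^0=1$ is used in the formulas. Twisted Heisenberg-Virasoro algebra $\mathbb T$: the Lie algebra with basis $\{L_n,I_n,C_L,C_{LI},C_I\mid n\in\mathbb Z\}$, with $C_L,C_{LI},C_I$ central and $[L_m,L_n]=(n-m)L_{m+n}+\frac1{12}(m^3-m)C_L\delta_{m+n,0}$, $[L_m,I_n]=nI_{m+n}+(m^2+m)C_{LI}\delta_{m+n,0}$, $[I_m,I_n]=mC_I\delta_{m+n,0}$. For $n\in\mathbb N$, $\mathbb T_n=\mathrm{Span}_{\mathbb C}\{L_k,I_{n+k}\mid k\in\mathbb N\}$, a subalgebra of $\mathbb T$. For $h,q\in\mathbb N$ with $h\ge n$, a $\mathbb T_n$-module $V$ has annihilating level $(h,q)$ if $I_hV\ne0$, $L_qV\ne0$ and $I_kV=L_lV=0$ for all $k>h$, $l>q$. $\min\{\boldsymbol d\}=\min\{d_0,\dots,d_{p-1}\}$. $M_{\mathbb T}(V,a,\boldsymbol d)$ denotes the $\mathbb T$-module $V\otimes\mathbb C[x^{\pm1}]$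 with, writing $v(k)=v\otimes x^k$, $$L_m\cdot v(k)=\Big(a+k+\sum_{j=0}^\infty\frac{m^{j+1}}{(j+1)!}L_j\Big)v(m+k),\quad I_{pm+i}\cdot v(k)=\sum_{j=0}^\infty\frac{(pm+i)^{j+d_i}}{(j+d_i)!}I_{j+d_i}v(pm+i+k),$$ $$C_L\cdot v(k)=C_{LI}\cdot v(k)=C_I\cdot v(k)=0$$ for $m,k\in\mathbb Z$, $v\in V$, $0\le i\le p-1$. *)

(* Defs.v *)
From HB Require Import structures.
From mathcomp Require Import all_boot all_order all_algebra.
From mathcomp Require Import finmap complex.
From mathcomp Require Import mathcomp_extra boolp classical_sets functions.
From mathcomp Require Import cardinality fsbigop reals.

Set Implicit Arguments.
Unset Strict Implicit.
Unset Printing Implicit Defensive.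

Import Order.TTheory GRing.Theory Num.Theory.
Local Open Scope classical_set_scope.
Local Open Scope ring_scope.

(* Finitely supported functions X -> V, i.e. the direct sum of copies of V
   indexed by X. It serves both as the space with a given basis X (V = C) and
   as V (x) C[x, x^-1] (X = int, where [f k] is the coefficient of x^k). *)
Section FinSupp.
Context {K : pzRingType} (X : choiceType) (V : lmodType K).

Definition finsupp_pred : {pred X -> V} :=
  fun f => `[< finite_set [set x | f x != 0] >].

Record finsupp := FinSupp {
  finsupp_fun :> X -> V;
  _ : finsupp_fun \in finsupp_pred }.

HB.instance Definition _ := [isSub for finsupp_fun].
HB.instance Definition _ := [Choice of finsupp by <:].

Lemma finsupp_submod_closed : GRing.submod_closed finsupp_pred.
Proof.
split=> [|c f g]; rewrite !inE.
  apply: (@sub_finite_set _ _ set0); last exact: finite_set0.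
  by move=> x /=; rewrite eqxx.
move=> finf fing.
have fg : finite_set ([set x | f x != 0] `|` [set x | g x != 0]).
  by rewrite finite_setU.
apply: sub_finite_set fg => x /=; apply: contraNP.
move=> /not_orP[/negP/negPn/eqP f0 /negP/negPn/eqP g0].
by rewrite !fctE /= f0 g0 scaler0 addr0.
Qed.

HB.instance Definition _ :=
  GRing.isSubmodClosed.Build K (X -> V) finsupp_pred finsupp_submod_closed.
HB.instance Definition _ :=
  [SubChoice_isSubLmodule of finsupp by <:].

Lemma single_subproof (x : X) (v : V) :
  (fun y => if y == x then v else 0) \in finsupp_pred.
Proof.
apply/asboolP; apply: (@sub_finite_set _ _ [set x]); last exact: finite_set1.
by move=> y /=; case: (eqVneq y x) => // _; rewrite eqxx.
Qed.

Definition single (x : X) (v : V) : finsupp := FinSupp (single_subproof x v).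

Lemma fsbig_only (M : nmodType) (F : X -> M) (x : X) :
  (forall y, y != x -> F y = 0) -> \sum_(y \in [set: X]) F y = F x.
Proof.
move=> F0; rewrite -[RHS](fsbig_set1 +%R x F); apply/esym/fsbig_widen => //.
by move=> y [_ /=] yx; apply: F0; apply/eqP.
Qed.

Lemma single0 (x : X) : single x 0 = 0.
Proof.
apply: val_inj; apply/funext => y /=; case: (y == x); by [].
Qed.

End FinSupp.

Notation "{ 'finsupp' X -> V }" := (@finsupp _ X V)
  (at level 0, X at level 98, V at level 99,
   format "{ 'finsupp'  X  ->  V }") : type_scope.

Section Subspaces.
Context {K : pzRingType} {V : lmodType K}.

Definition subspace (U : set V) : Prop :=
  U 0 /\ forall (c : K) (u v : V), U u -> U v -> U (c *: u + v).

Definition lspan (A : set V) : set V := smallest subspace A.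

End Subspaces.

Inductive Tbasis : Type :=
  | bL of int | bI of int | bCL | bCLI | bCI.

Definition Tbasis_encode (b : Tbasis) : int + int + 'I_3 :=
  match b with
  | bL n => inl (inl n)
  | bI n => inl (inr n)
  | bCL => inr (inord 0)
  | bCLI => inr (inord 1)
  | bCI => inr (inord 2)
  end.

Definition Tbasis_decode (c : int + int + 'I_3) : Tbasis :=
  match c with
  | inl (inl n) => bL n
  | inl (inr n) => bI n
  | inr i => nth bCL [:: bCL; bCLI; bCI] i
  end.

Lemma Tbasis_encodeK : cancel Tbasis_encode Tbasis_decode.
Proof. by case=> //=; rewrite inordK. Qed.

HB.instance Definition _ := Countable.copy Tbasis (can_type Tbasis_encodeK).

Section TwistedHeisenbergVirasoro.
Context {R : realType}.
Local Notation C := R[i].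

Definition THV : Type := {finsupp Tbasis -> C^o}.
HB.instance Definition _ := GRing.Lmodule.on THV.

Definition Tgen (b : Tbasis) : THV := single b (1 : C^o).
Definition TL (n : int) : THV := Tgen (bL n).
Definition TI (n : int) : THV := Tgen (bI n).
Definition TCL : THV := Tgen bCL.
Definition TCLI : THV := Tgen bCLI.
Definition TCI : THV := Tgen bCI.

Definition bracketLI (m n : int) : THV :=
  n%:~R *: TI (m + n) + ((m ^+ 2 + m)%:~R * (m + n == 0)%:R) *: TCLI.

Definition bracket_basis (b c : Tbasis) : THV :=
  match b, c with
  | bL m, bL n => (n - m)%:~R *: TL (m + n)
      + (12%:R^-1 * (m ^+ 3 - m)%:~R * (m + n == 0)%:R) *: TCL
  | bL m, bI n => bracketLI m n
  | bI m, bL n => - bracketLI n m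
  | bI m, bI n => (m%:~R * (m + n == 0)%:R) *: TCI
  | _, _ => 0
  end.

Definition bracket (x y : THV) : THV :=
  \sum_(b \in [set: Tbasis]) \sum_(c \in [set: Tbasis])
    (x b * y c) *: bracket_basis b c.

Lemma bracket_Tgen (b c : Tbasis) :
  bracket (Tgen b) (Tgen c) = bracket_basis b c.
Proof.
rewrite /bracket (@fsbig_only _ _ _ b) => [|b' b'b].
  rewrite (@fsbig_only _ _ _ c) => [|c' c'c].
    by rewrite /= !eqxx mulr1 scale1r.
  by rewrite /= (negbTE c'c) mulr0 scale0r.
by apply: fsbig1 => c' _; rewrite /= (negbTE b'b) mul0r scale0r.
Qed.

Definition Tsub (n : nat) : set THV :=
  lspan [set x | exists k : nat, x = TL k \/ x = TI (n + k)%N].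

(* In the definitions below, g is meant to be a Lie subalgebra of THV; an
   action is a function on all of THV, of which only the values on g matter. *)
Section Modules.
Context {V : lmodType C}.

Definition is_module (g : set THV) (act : THV -> V -> V) : Prop :=
  [/\ forall x, g x -> linear (act x),
      forall (c : C) x y v, g x -> g y ->
        act (c *: x + y) v = c *: act x v + act y v
    & forall x y v, g x -> g y ->
        act (bracket x y) v = act x (act y v) - act y (act x v)].

Definition submodule (g : set THV) (act : THV -> V -> V) (U : set V) : Prop :=
  subspace U /\ forall x u, g x -> U u -> U (act x u).

(* Irreducibility only depends on the operators [act x], x in g, and is defined
   without requiring [is_module g act]; see the remark before [MT]. *)
Definition irreducible (g : set THV) (act : THV -> V -> V) : Prop :=
  (exists v : V, v <> 0) /\
  forall U : set V, submodule g act U -> U = [set 0] \/ U = [set: V].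

Definition annihilating_level (n : nat) (act : THV -> V -> V) (h q : nat) :
    Prop :=
  [/\ (n <= h)%N,
      exists v, act (TI h) v <> 0,
      exists v, act (TL q) v <> 0,
      forall (k : nat) v, (h < k)%N -> act (TI k) v = 0
    & forall (l : nat) v, (q < l)%N -> act (TL l) v = 0].

End Modules.

Section LoopModule.
Variables (p : nat) (V : lmodType C) (act : THV -> V -> V) (a : C).
Variable d : {ffun 'I_p -> 'I_2}.

(* The initial value 1 is harmless for p > 0: all entries of d are at most 1. *)
Definition mind : nat := \big[minn/1%N]_(i < p) (d i : nat).

(* d_i for i the residue of n modulo p; the default 0 is never used if p > 0. *)
Definition dres (n : int) : nat :=
  oapp (fun i : 'I_p => d i : nat) 0%N (insub `|(n %% p)%Z|%N).

(* The space V (x) C[x, x^-1]; [single k v] is v(k). *)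
Definition MTspace : Type := {finsupp int -> V}.
HB.instance Definition _ := GRing.Lmodule.on MTspace.

Definition MT_L (m k : int) (v : V) : MTspace :=
  single (m + k) ((a + k%:~R) *: v
    + \sum_(j \in [set: nat]) (m%:~R ^+ j.+1 / (j.+1)`!%:R) *: act (TL j) v).

Definition MT_I (n k : int) (v : V) : MTspace :=
  single (n + k) (\sum_(j \in [set: nat])
    (n%:~R ^+ (j + dres n) / (j + dres n)`!%:R) *: act (TI (j + dres n)%N) v).

Definition MT_basis (b : Tbasis) (k : int) (v : V) : MTspace :=
  match b with
  | bL m => MT_L m k v
  | bI n => MT_I n k v
  | _ => 0
  end.

(* The linear extension in x and in the v(k) of the action on basis elements.
   For constant d it satisfies the commutation relations of THV; when d takes
   both values 0 and 1, [L_m, I_n] = n I_(m+n) forces I_0 to act as 0 on V (take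
   d_i = 1 for the residue i of n <> 0 and d_i = 0 for that of m + n). *)
Definition MT (x : THV) (f : MTspace) : MTspace :=
  \sum_(b \in [set: Tbasis]) \sum_(k \in [set: int])
    x b *: MT_basis b k (f k).

Hypothesis act0 : forall b, act (Tgen b) 0 = 0.

Lemma MT_basis0 (b : Tbasis) (k : int) : MT_basis b k 0 = 0.
Proof.
case: b => [m|n|||] //=; rewrite /MT_L /MT_I ?scaler0 ?add0r.
all: by rewrite fsbig1 ?single0 // => j _; rewrite act0 scaler0.
Qed.

Lemma MT_single (b : Tbasis) (k : int) (v : V) :
  MT (Tgen b) (single k v) = MT_basis b k v.
Proof.
rewrite /MT (@fsbig_only _ _ _ b) => [|b' b'b].
  rewrite (@fsbig_only _ _ _ k) => [|k' k'k].
    by rewrite /= !eqxx scale1r.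
  by rewrite /= (negbTE k'k) MT_basis0 scaler0.
by apply: fsbig1 => k' _; rewrite /= (negbTE b'b) scale0r.
Qed.

Lemma dresE (m : int) (i : 'I_p) : dres (p%:Z * m + i%:Z) = d i.
Proof.
have p0 : (0 < p)%N by case: (i) => i' /(leq_ltn_trans (leq0n _)).
rewrite /dres mulrC modzMDl modz_small ?ltz_nat ?ltn_ord //= insubT //= => ip.
by congr (nat_of_ord (d _)); exact: val_inj.
Qed.

End LoopModule.

End TwistedHeisenbergVirasoro.

Arguments THV : clear implicits.

(* Main.v *)
(* A nonzero invariant subspace W of M is graded, since L_0 acts on v(k) by
   a + k; write W_k for its components. The operators L_m and I_m depend
   polynomially on m along each residue class modulo p, so whenever a composite
   of them maps W_k to W_s for infinitely many m, so does each of its coefficients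
   (invertibility of Vandermonde matrices). Consequently the intersection U of all
   W_k is a submodule of V. For irreducible V the operator I_h is injective, as its
   kernel is a submodule; and I_h^2 maps every W_k into U. Hence U is nonzero, so
   U = V and W = M. *)

Require Import Defs.
From HB Require Import structures.
From mathcomp Require Import all_boot all_order all_algebra.
From mathcomp Require Import finmap complex.
From mathcomp Require Import mathcomp_extra boolp classical_sets functions.
From mathcomp Require Import cardinality fsbigop reals.
From mathcomp Require Import zify ring.

Set Implicit Arguments.
Unset Strict Implicit.
Unset Printing Implicit Defensive.

Local Open Scope classical_set_scope.
Local Open Scope ring_scope.

Import Order.TTheory GRing.Theory Num.Theory.

(** * Subspaces and the extraction of polynomial coefficients *)

Section SubspaceTheory.
Context {K : pzRingType} {V : lmodType K} (U : set V).
Hypothesis subU : subspace U.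

Lemma subspaceD (u v : V) : U u -> U v -> U (u + v).
Proof. by move=> Uu Uv; rewrite -[u]scale1r; apply: subU.2. Qed.

Lemma subspaceZ (c : K) (u : V) : U u -> U (c *: u).
Proof. by move=> Uu; rewrite -[_ *: _]addr0; apply: subU.2 => //; exact: subU.1. Qed.

Lemma subspaceB (u v : V) : U u -> U v -> U (u - v).
Proof. by move=> Uu Uv; rewrite -scaleN1r addrC; apply: subU.2. Qed.

Lemma subspace_sum (I : Type) (r : seq I) (P : pred I) (F : I -> V) :
  (forall i, P i -> U (F i)) -> U (\sum_(i <- r | P i) F i).
Proof. by move=> UF; apply: big_ind => //; [exact: subU.1 | exact: subspaceD]. Qed.

End SubspaceTheory.

Lemma subspace_lspan (K : pzRingType) (V : lmodType K) (A : set V) :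
  subspace (lspan A).
Proof.
split=> [U [[U0 _] _] //|c u v Au Av U [subU AU]].
by apply: subU.2; [apply: Au | apply: Av].
Qed.

(** Distinct nodes make the Vandermonde matrix invertible, and its inverse writes each [v e] as a
    combination of the first [N] given sums. *)
Lemma subspace_coef (F : fieldType) (V : lmodType F) (U : set V) (N : nat)
    (x : nat -> F) (v : nat -> V) :
  subspace U -> injective x ->
  (forall t, U (\sum_(e < N) x t ^+ e *: v e)) ->
  forall e, (e < N)%N -> U (v e).
Proof.
move=> subU injx Ux e eN.
pose A := Vandermonde N (\row_(t < N) x t).
have unitA : A \in unitmx.
  rewrite unitmxE unitfE det_Vandermonde.
  apply/prodf_neq0 => i _; apply/prodf_neq0 => j ij.
  rewrite !mxE subr_eq0; apply/eqP => /injx /val_inj eji.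
  by rewrite eji ltnn in ij.
pose eo := Ordinal eN.
have -> : v e =
    \sum_(t < N) invmx A t eo *: (\sum_(i < N) x t ^+ i *: v i).
  transitivity (\sum_(i < N) (A *m invmx A) i eo *: v i).
    rewrite mulmxV // (bigD1 eo) //= mxE eqxx scale1r big1 ?addr0 // => i ie.
    by rewrite mxE (negbTE ie) scale0r.
  under [RHS]eq_bigr do rewrite scaler_sumr.
  rewrite exchange_big /=; apply: eq_bigr => i _.
  rewrite mxE scaler_suml; apply: eq_bigr => t _.
  by rewrite !mxE scalerA mulrC.
by apply: subspace_sum => // t _; apply: subspaceZ.
Qed.

Lemma subspace_poly_coef (F : fieldType) (V : lmodType F) (U : set V)
    (J : finType) (x : nat -> F) (P : J -> {poly F}) (v : J -> V) :
  subspace U -> injective x ->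
  (forall t, U (\sum_j (P j).[x t] *: v j)) ->
  forall e, U (\sum_j (P j)`_e *: v j).
Proof.
(* [N] bounds every [size (P j)] and exceeds [e], so that coefficients beyond the degree, which are
   zero, are covered too. *)
move=> subU injx Ux e; pose N := maxn e.+1 (\max_j size (P j)).
apply: (@subspace_coef _ _ _ N x (fun e => \sum_j (P j)`_e *: v j)) => //.
  move=> t; have := Ux t; congr U.
  under [RHS]eq_bigr do rewrite scaler_sumr.
  rewrite exchange_big /=; apply: eq_bigr => j _.
  rewrite (@horner_coef_wide _ N); last by rewrite leq_max leq_bigmax ?orbT.
  by rewrite scaler_suml; apply: eq_bigr => i _; rewrite scalerA mulrC.
by rewrite leq_max ltnSn.
Qed.

(** * Finitely supported functions as sums of their homogeneous parts *)

Section FinSuppTheory.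
Context {K : pzRingType} {X : choiceType} {V : lmodType K}.
Implicit Types f g : {finsupp X -> V}.

Lemma finsuppP f g : (forall x, f x = g x) -> f = g.
Proof. by move=> fg; apply: val_inj; apply/funext. Qed.

Lemma finsuppZE (c : K) f x : (c *: f) x = c *: f x.
Proof. by []. Qed.

Lemma finsuppDE f g x : (f + g) x = f x + g x.
Proof. by []. Qed.

Lemma finsupp0E x : (0 : {finsupp X -> V}) x = 0.
Proof. by []. Qed.

Lemma singleE (x y : X) (v : V) : single x v y = if y == x then v else 0.
Proof. by []. Qed.

Lemma single_linear (x : X) (c : K) (u v : V) :
  single x (c *: u + v) = c *: single x u + single x v.
Proof.
apply: finsuppP => y; rewrite finsuppDE finsuppZE !singleE.
by case: ifP; rewrite // scaler0 addr0.
Qed.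

Lemma fin_supp_finite f : finite_set [set x | f x != 0].
Proof. by case: f => f /= /asboolP. Qed.

(** [F] is kept apart from [f] so that it can be a bare formula, with the finiteness of its support
    carried by [f]. *)
Lemma fsum_single (F : X -> V) f : (forall x, f x = F x) ->
  \sum_(x \in [set: X]) single x (F x) = f.
Proof.
move=> fF; rewrite (fsbigTE (fset_set [set x | f x != 0])); last first.
  move=> x; rewrite in_fset_set; last exact: fin_supp_finite.
  rewrite notin_setE /= => /negP; rewrite negbK -fF => /eqP ->.
  exact: single0.
apply: finsuppP => y.
have evD : {morph (fun g => g y) : g g' / g + g'} by [].
rewrite (big_morph (fun g => g y) evD (finsupp0E y)).
under eq_bigr do rewrite singleE.
case: (boolP (y \in fset_set [set x | f x != 0])) => yf.
  rewrite (bigD1_seq y) ?fset_uniq //= eqxx big1 ?addr0 ?fF // => x.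
  by rewrite eq_sym => /negbTE ->.
rewrite big1_seq => [|x /andP[_ xf]]; last first.
  by case: eqVneq => // yx; rewrite yx xf in yf.
move: yf; rewrite in_fset_set; last exact: fin_supp_finite.
by rewrite notin_setE /= => /negP; rewrite negbK => /eqP ->.
Qed.

End FinSuppTheory.

(** * Modules over the subalgebra [Tsub n] *)

Section LieModules.
Context {R : realType} {V : lmodType R[i]} {n : nat}.
Context {act : THV R -> V -> V}.

Lemma Tsub_TL (j : nat) : Tsub n (TL j : THV R).
Proof. by move=> U [_]; apply; exists j; left. Qed.

Lemma Tsub_TI (j : nat) : (n <= j)%N -> Tsub n (TI j : THV R).
Proof.
by move=> nj U [_]; apply; exists (j - n)%N; right; rewrite subnKC.
Qed.

Lemma act_TL_linear : is_module (Tsub n) act -> forall j : nat, linear (act (TL j)).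
Proof. by case=> lin _ _ j; apply: lin; apply: Tsub_TL. Qed.

Lemma act_TI_linear : is_module (Tsub n) act ->
  forall j : nat, (n <= j)%N -> linear (act (TI j)).
Proof. by case=> lin _ _ j nj; apply: lin; apply: Tsub_TI. Qed.

Lemma linear_map0 (f : V -> V) : linear f -> f 0 = 0.
Proof.
by move=> linf; have := linf (-1) 0 0; rewrite scaler0 addr0 scaleN1r addNr.
Qed.

Lemma linear_map_sum (f : V -> V) (J : finType) (c : J -> R[i]) (v : J -> V) :
  linear f -> f (\sum_j c j *: v j) = \sum_j c j *: f (v j).
Proof.
move=> linf; elim/big_rec2: _ => [|j _ u _ <-]; first exact: linear_map0.
by rewrite linf.
Qed.

Lemma act0l : is_module (Tsub n) act -> forall v, act 0 v = 0.
Proof.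
case=> _ lin _ v; have g0 := (subspace_lspan
  [set x : THV R | exists k : nat, x = TL k \/ x = TI (n + k)%N]).1.
by have := lin (-1) 0 0 v g0 g0; rewrite scaler0 addr0 scaleN1r addNr.
Qed.

Lemma actZl : is_module (Tsub n) act ->
  forall c x v, Tsub n x -> act (c *: x) v = c *: act x v.
Proof.
move=> Vmod c x v gx; have [_ lin _] := Vmod.
rewrite -[c *: x]addr0 lin //; first by rewrite act0l ?addr0.
exact: (subspace_lspan _).1.
Qed.

(** For fixed [u], the elements of [Tsub n] that send [u] into [U] form a subspace; as [Tsub n] is a
    linear span, it suffices that this subspace contains the spanning vectors. *)
Lemma submodule_gens (U : set V) : is_module (Tsub n) act -> subspace U ->
  (forall (j : nat) u, U u -> U (act (TL j) u)) ->
  (forall (j : nat) u, (n <= j)%N -> U u -> U (act (TI j) u)) ->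
  submodule (Tsub n) act U.
Proof.
move=> Vmod subU UL UI; split=> // x u gx Uu.
pose G := [set y | Tsub n y /\ U (act y u)].
have [subT lin _] := Vmod.
suff /(_ x gx)[] : Tsub n `<=` G by [].
apply: smallest_sub.
  split=> [|c y z [gy Uy] [gz Uz]].
    by split; [exact: (subspace_lspan _).1 | rewrite act0l //; exact: subU.1].
  split; first exact: (subspace_lspan _).2.
  by rewrite lin //; apply: subU.2.
move=> _ [k [->|->]]; split; try by [exact: Tsub_TL | exact: UL].
  by apply: Tsub_TI; rewrite leq_addr.
by apply: UI => //; rewrite leq_addr.
Qed.

(** The kernel of I_h is a submodule: [L_j, I_h] = h I_(j+h), which vanishes on V for j > 0 and is a
    multiple of I_h for j = 0, while I_j and I_h commute. It is proper because I_h is nonzero on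
    V. *)
Lemma act_TI_top_injective (h q : nat) :
  is_module (Tsub n) act -> annihilating_level n act h q ->
  irreducible (Tsub n) act -> forall v, act (TI h) v = 0 -> v = 0.
Proof.
move=> Vmod [nh [v0 Iv0] _ Ih _] [_ irr] v Iv.
have lin := act_TI_linear Vmod nh.
have br x y w : Tsub n x -> Tsub n y ->
    act (bracket x y) w = act x (act y w) - act y (act x w).
  by case: Vmod => _ _; apply.
have [||] // := irr [set w | act (TI h) w = 0].
- apply: submodule_gens => //= [|j u Iu|j u nj Iu].
  + split; first exact: linear_map0.
    by move=> c u w /= Iu Iw; rewrite lin Iu Iw scaler0 addr0.
  + have := br (TL j) (TI h) u (Tsub_TL j) (Tsub_TI nh).
    rewrite Iu (linear_map0 (act_TL_linear Vmod j)) sub0r.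
    rewrite /TL [TI h]/TI bracket_Tgen /= /bracketLI.
    (* The central term dies: with nonnegative indices, j + h = 0 forces j = 0. *)
    have -> : (j%:Z ^+ 2 + j%:Z)%:~R * (j%:Z + h == 0)%:R = 0 :> R[i].
      by case: j => [|j] /=; rewrite ?mul0r // mulr0.
    rewrite scale0r addr0 -[_ + _]/((j + h)%N : int).
    rewrite actZl //; last by apply: Tsub_TI; rewrite (leq_trans nh) ?leq_addl.
    have -> : act (TI (j + h)%N) u = 0.
      by case: j => [|j] //; apply: Ih; rewrite addSn ltnS leq_addl.
    by rewrite scaler0 => /esym/eqP; rewrite oppr_eq0 => /eqP.
  have := br (TI j) (TI h) u (Tsub_TI nj) (Tsub_TI nh).
  rewrite Iu (linear_map0 (act_TI_linear Vmod nj)) sub0r.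
  rewrite [TI j]/TI [TI h]/TI bracket_Tgen /=.
  have -> : j%:~R * (j%:Z + h == 0)%:R = 0 :> R[i].
    by case: j {nj} => [|j] /=; rewrite ?mul0r // mulr0.
  by rewrite scale0r act0l // => /esym/eqP; rewrite oppr_eq0 => /eqP.
- by move=> /seteqP[/(_ v Iv)].
- by move=> /seteqP[_ /(_ v0 I)].
Qed.

End LieModules.

(** * The entries of [d] along residue classes modulo [p] *)

Section Residues.
Context {p : nat} (d : {ffun 'I_p -> 'I_2}).

Lemma dres_period (t m : int) : dres d (p%:Z * t + m) = dres d m.
Proof. by rewrite /dres mulrC modzMDl. Qed.

Lemma mind_le1 : (mind d <= 1)%N.
Proof.
by rewrite /mind; elim/big_rec: _ => // i x _; rewrite geq_min => ->; rewrite orbT.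
Qed.

Lemma mind_le (i : 'I_p) : (mind d <= d i)%N.
Proof.
rewrite /mind; elim: index_enum (mem_index_enum i) => // j r IH.
rewrite inE big_cons geq_min => /orP[/eqP <-|/IH ->]; last by rewrite orbT.
by rewrite leqnn.
Qed.

Lemma dres_insub (m : int) : (0 < p)%N -> exists i, dres d m = d i.
Proof.
move=> p0; rewrite /dres; case: insubP => [i _ _|]; first by exists i.
have m0 : 0 <= (m %% p)%Z by rewrite modz_ge0 // -lt0n.
by rewrite -ltz_nat gez0_abs // ltz_pmod.
Qed.

Lemma mind_le_dres (m : int) : (0 < p)%N -> (mind d <= dres d m)%N.
Proof. by move=> /(dres_insub m)[i ->]; exact: mind_le. Qed.

Lemma dres_le1 (m : int) : (0 < p)%N -> (dres d m <= 1)%N.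
Proof. by move=> /(dres_insub m)[i ->]; rewrite -ltnS ltn_ord. Qed.

(** Either some entry is 0, hence minimal, or all entries equal 1, which is also the initial value
    in [mind]. *)
Lemma dres_mind : (0 < p)%N -> exists m : int, dres d m = mind d.
Proof.
move=> p0; suff [i <-] : exists i, d i = mind d :> nat.
  by exists i%:Z; rewrite -(dresE d 0) mulr0 add0r.
case: (boolP [exists i, d i == 0 :> nat]) => [/existsP[i /eqP di]|].
  by exists i; have := mind_le i; rewrite di leqn0 => /eqP.
rewrite negb_exists => /forallP dn0.
have d1 i : d i = 1%N :> nat.
  by apply/eqP; rewrite eqn_leq -ltnS ltn_ord lt0n dn0.
exists (Ordinal p0); rewrite d1 /mind.
by elim/big_rec: _ => // i x _ <-; rewrite d1.
Qed.

End Residues.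

(** * Families of subspaces of V, indexed by degree and stable under the L_m and I_m *)

Section GradedSubspaces.
Context {R : realType} {p : nat} (p0 : (0 < p)%N) (a : R[i]) (h q : nat).
Context (d : {ffun 'I_p -> 'I_2}) {V : lmodType R[i]} {act : THV R -> V -> V}.
Hypothesis Vmod : is_module (Tsub (mind d)) act.
Hypothesis Vlevel : annihilating_level (mind d) act h q.

Definition Lpoly (b x : R[i]) (v : V) : V :=
  b *: v + \sum_(j < q.+1) (x ^+ j.+1 / (j.+1)`!%:R) *: act (TL j) v.

(** The cutoff [e <= j] replaces the index shift by d_i, so that the summation range is the same for
    all residues. *)
Definition Ipoly (e : nat) (x : R[i]) (v : V) : V :=
  \sum_(j < h.+1) ((e <= j)%:R * (x ^+ j / j`!%:R)) *: act (TI j) v.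

Context (W : int -> set V).
Hypothesis Wsub : forall k, subspace (W k).
Hypothesis WL : forall m k v, W k v ->
  W (m + k) (Lpoly (a + k%:~R) m%:~R v).
Hypothesis WI : forall m k v, W k v ->
  W (m + k) (Ipoly (dres d m) m%:~R v).

Lemma progression_injective (r : int) :
  injective (fun t : nat => (p%:Z * t + r)%:~R : R[i]).
Proof.
have p_neq0 : p%:Z != 0 by rewrite eqz_nat -lt0n.
by move=> t t' /intr_inj /addIr /(mulfI p_neq0) [].
Qed.

Lemma fact_unit (j : nat) : j`!%:R != 0 :> R[i].
Proof. by rewrite pnatr_eq0 -lt0n fact_gt0. Qed.

(** L_m sends degree s - m to degree s with scalar part a + s - m. As a polynomial in m this has
    constant term a + s, and its -m joins the linear coefficient L_0; hence the correction at j =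
    0. *)
Lemma TL_coef (s r : int) (u : V) :
  (forall t : nat, W (s - (p%:Z * t + r)) u) ->
  W s ((a + s%:~R) *: u) /\
  forall j : nat, W s (act (TL j) u - (j == 0)%:R *: u).
Proof.
move=> Wu; pose v e := if e is j.+1
  then (j.+1)`!%:R^-1 *: act (TL j) u - (j == 0)%:R *: u
  else (a + s%:~R) *: u.
have Wv : forall e, (e < q.+2)%N -> W s (v e).
  apply: (@subspace_coef _ _ _ _ _ v (Wsub s) (@progression_injective r)) => t.
  set m := p%:Z * t + r; have := WL m (Wu t); rewrite subrKC /Lpoly; congr (W s _).
  rewrite [in RHS]big_ord_recl /= expr0 scale1r rmorphB /=.
  under [in RHS]eq_bigr do rewrite scalerBr scalerA.
  rewrite addrA scalerBl addrAC sumrB [in RHS]addrA; congr (_ + _ - _).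
  rewrite big_ord_recl /= expr1 scale1r big1 ?addr0 // => i _.
  by rewrite scale0r scaler0.
split=> [|j]; first exact: (Wv 0%N).
have [jq|qj] := leqP j q; last first.
  have [_ _ _ _ ->//] := Vlevel.
  by rewrite gtn_eqF ?(leq_ltn_trans _ qj) // scale0r subr0; exact: (Wsub s).1.
have /(subspaceZ (Wsub s) (j.+1)`!%:R) := Wv j.+1 jq.
rewrite /v scalerBr !scalerA divff ?fact_unit // scale1r.
by case: (j =P 0%N) => [->|_]; rewrite ?mulr1 ?mulr0.
Qed.

(** Along m congruent to r modulo p the entry [dres d m] is constant, so I_m is a single polynomial
    in m there. *)
Lemma TI_coef (s r : int) (u : V) :
  (forall t : nat, W (s - (p%:Z * t + r)) u) ->
  forall j : nat, (dres d r <= j)%N -> W s (act (TI j) u).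
Proof.
move=> Wu j rj.
have [jh|hj] := leqP j h; last first.
  by have [_ _ _ -> // _] := Vlevel; exact: (Wsub s).1.
pose v e := ((dres d r <= e)%:R / e`!%:R) *: act (TI e) u.
have : W s (v j).
  apply: (@subspace_coef _ _ _ h.+1 _ v (Wsub s) (@progression_injective r)) => //.
  move=> t; have := WI (p%:Z * t + r) (Wu t); rewrite subrKC dres_period.
  congr (W s _); apply: eq_bigr => i _.
  by rewrite scalerA mulrCA.
move=> /(subspaceZ (Wsub s) j`!%:R).
by rewrite /v rj scalerA mul1r divff ?fact_unit // scale1r.
Qed.

Lemma bigcap_submodule : submodule (Tsub (mind d)) act [set v | forall k, W k v].
Proof.
apply: submodule_gens => //= [|j u Wu k|j u dj Wu k].
- split=> [k|c u v Wu Wv k]; first exact: (Wsub k).1.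
  by apply: (Wsub k).2.
- have [_ /(_ j)] := @TL_coef k 0 u (fun=> Wu _).
  move=> /(subspaceD (Wsub k))/(_ (subspaceZ (Wsub k) (j == 0)%:R (Wu k))).
  by rewrite subrK.
(* A residue attaining the minimum yields every I_j of the subalgebra. *)
have [r rd] := dres_mind d p0.
by apply: (@TI_coef k r) => //; rewrite rd.
Qed.

(** The product has degree i + j, which reaches 2h only for i = j = h; the leading coefficient is
    then (-1)^h. *)
Lemma coef_top_XnM (c : R[i]) (i j : nat) : (i <= h)%N -> (j <= h)%N ->
  ('X^i * (c%:P - 'X) ^+ j)`_(h + h) = ((i == h) && (j == h))%:R * (-1) ^+ h.
Proof.
move=> ih jh; rewrite coefXnM ltnNge (leq_trans ih) ?leq_addr //=.
rewrite -opprB (exprNn ('X - c%:P)).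
have -> : (-1) ^+ j = ((-1) ^+ j)%:P :> {poly R[i]} by rewrite rmorphXn /= rmorphN.
rewrite coefCM.
case: eqVneq => [->|ineq] /=; last first.
  rewrite nth_default ?mul0r ?mulr0 // size_exp_XsubC.
  by rewrite ltn_subRL; have := ltn_neqAle i h; rewrite ineq ih; lia.
rewrite addnK; case: eqVneq => [->|jneq] /=.
  have /monicP := monic_exp h (monicXsubC c).
  by rewrite lead_coefE size_exp_XsubC /= => ->; rewrite mulr1 mul1r.
by rewrite nth_default ?mul0r ?mulr0 // size_exp_XsubC ltn_neqAle jneq.
Qed.

(* [TI h] squared is, up to a nonzero scalar, the coefficient of [x ^ (2 h)] in
   [I_x I_(s - k - x)], which maps [W k] to [W s]; this is a polynomial in [x] on
   the multiples [x] of [p]. *)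
Lemma TI_top_sqr_pos (k s : int) (w : V) : (0 < h)%N ->
  W k w -> W s (act (TI h) (act (TI h) w)).
Proof.
move=> h0 Wkw; have [dh _ _ _ _] := Vlevel.
pose s' := s - k; pose e0 := dres d 0; pose e1 := dres d s'.
pose P (ij : 'I_h.+1 * 'I_h.+1) : {poly R[i]} :=
  ((e0 <= ij.1)%:R / (ij.1)`!%:R * ((e1 <= ij.2)%:R / (ij.2)`!%:R)) *:
  ('X^(ij.1) * ((s'%:~R)%:P - 'X) ^+ ij.2).
pose v (ij : 'I_h.+1 * 'I_h.+1) := act (TI ij.1) (act (TI ij.2) w).
(* Entries of [d] are at most 1, so h > 0 keeps the I_h term in both factors. *)
have e0h : (e0 <= h)%N by apply: leq_trans h0; exact: dres_le1.
have e1h : (e1 <= h)%N by apply: leq_trans h0; exact: dres_le1.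
pose c : R[i] := (h`!%:R)^-1 * (h`!%:R)^-1 * (-1) ^+ h.
have c0 : c != 0.
  by rewrite /c !mulf_neq0 ?invr_eq0 ?fact_unit // expf_neq0 // oppr_eq0 oner_eq0.
suff : W s (c *: act (TI h) (act (TI h) w)).
  by move=> /(subspaceZ (Wsub s) c^-1); rewrite scalerA mulVf // scale1r.
have -> : c *: act (TI h) (act (TI h) w) = \sum_j (P j)`_(h + h) *: v j.
  rewrite (bigD1 (ord_max, ord_max)) //= big1 ?addr0.
    by rewrite /P /v /= e0h e1h coefZ coef_top_XnM // eqxx !mul1r.
  move=> [i j]; rewrite -pair_eqE /= -!val_eqE /= => /negbTE ij.
  rewrite /P /= coefZ coef_top_XnM -1?ltnS // ij mul0r mulr0.
  exact: scale0r.
(* For m a multiple of p, both m and s' - m stay in fixed residue classes, with entries [e0] and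
   [e1]. *)
apply: (subspace_poly_coef (Wsub s) (@progression_injective 0)) => t.
set m := p%:Z * t + 0.
have mE : dres d m = e0 by rewrite /m dres_period.
have smE : dres d (s' - m) = e1.
  by rewrite /m addr0 -mulrN addrC dres_period.
have := WI m (WI (s' - m) Wkw); rewrite mE smE.
have -> : m + (s' - m + k) = s by rewrite addrA subrKC subrK.
congr (W s _); rewrite -(pair_bigA _ (fun i j => (P (i, j)).[m%:~R] *: v (i, j))) /=.
rewrite /Ipoly; apply: eq_bigr => i _.
have [e0i|ie0] := leqP e0 i; last first.
  rewrite mul0r scale0r big1 // => j _.
  by rewrite /P /= leqNgt ie0 !mul0r scale0r horner0 scale0r.
rewrite linear_map_sum; last first.
  by apply: (act_TI_linear Vmod); rewrite (leq_trans _ e0i) // mind_le_dres.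
rewrite scaler_sumr; apply: eq_bigr => j _; rewrite /P /v /= e0i scalerA.
congr (_ *: _); rewrite !hornerE /= rmorphB /=.
by ring.
Qed.

(* Here [I_m] acts as [TI 0] or [0], so [I_m] alone only links degrees differing
   by certain residues; composing with [L] reaches every degree but [- a],
   and one more [I_m] reaches [- a] from there. *)
Lemma TI_top_sqr_zero (k s : int) (w : V) : h = 0%N ->
  W k w -> W s (act (TI h) (act (TI h) w)).
Proof.
move=> h0; have [dh _ _ _ _] := Vlevel.
(* From [mind d <= h] and h = 0 the minimum is 0, so [r] has entry 0. *)
have [r rd] := dres_mind d p0; move: dh rd; rewrite h0 leqn0 => /eqP -> rd.
have I0 m k' u : dres d m = 0%N -> W k' u -> W (m + k') (act (TI 0%N) u).
  move=> m0 /(WI m); rewrite m0 /Ipoly h0 big_ord1 /= expr0.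
  by rewrite fact0 divr1 mulr1 scale1r.
have far k' s' u : a + s'%:~R != 0 -> W k' u -> W s' (act (TI 0%N) u).
  move=> as0 Wu.
  (* The indices r - pt have entry 0, so I_0 u lies in a whole progression of degrees r - pt + k'.
     The constant coefficient of the L_m leading from there to s' is a + s'. *)
  have [|/(subspaceZ (Wsub s') (a + s'%:~R)^-1)] :=
    @TL_coef s' (s' - k' - r) (act (TI 0%N) u) _; last first.
    by rewrite scalerA mulVf // scale1r.
  move=> t; have -> : s' - (p%:Z * t + (s' - k' - r)) = (p%:Z * - t%:Z + r) + k'.
    by rewrite mulrN; ring.
  by apply: I0; rewrite ?dres_period.
move=> Wkw; have [as0|] := eqVneq (a + s%:~R) 0; last first.
  by move=> as0; apply: (far s) => //; apply: far Wkw.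
(* For a + s = 0 the last step is an I_m from degree s - m, where a + s - m = -m must be nonzero; m
   = r serves, or m = p if r = 0. *)
have [m [m0 dm]] : exists m : int, m != 0 /\ dres d m = 0%N.
  case: (eqVneq r 0) => [r0|]; last by exists r.
  exists (p%:Z * 1 + r); rewrite dres_period; split=> //.
  by rewrite mulr1 r0 addr0 eqz_nat -lt0n.
rewrite -(subrKC m s); apply: I0 => //; apply: far Wkw.
by rewrite rmorphB /= addrA as0 sub0r oppr_eq0 intr_eq0.
Qed.

Lemma graded_full (k : int) (w : V) : irreducible (Tsub (mind d)) act ->
  W k w -> w <> 0 -> forall s v, W s v.
Proof.
move=> irr Wkw w0 s v.
have sqrW s' : W s' (act (TI h) (act (TI h) w)).
  have [h0|h0] := posnP h; [exact: TI_top_sqr_zero Wkw|exact: TI_top_sqr_pos Wkw].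
have [U0|UT] := irr.2 _ bigcap_submodule.
  have inj := act_TI_top_injective Vmod Vlevel irr.
  by case: w0; apply/inj/inj; have : [set 0] (act (TI h) (act (TI h) w)) by rewrite -U0.
by have : [set: V] v by []; rewrite -UT => /(_ s).
Qed.

End GradedSubspaces.

(** * Submodules of the loop module *)

Section LoopModuleSubmodules.
Context {R : realType} {p : nat} (p0 : (0 < p)%N) (a : R[i]) (h q : nat).
Context (d : {ffun 'I_p -> 'I_2}) {V : lmodType R[i]} {act : THV R -> V -> V}.
Hypothesis Vmod : is_module (Tsub (mind d)) act.
Hypothesis Vlevel : annihilating_level (mind d) act h q.

Lemma MT_LE (m k : int) (v : V) :
  MT_L act a m k v = single (m + k) (Lpoly (act := act) q (a + k%:~R) m%:~R v).
Proof.
rewrite /MT_L /Lpoly; congr (single _ (_ + _)).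
rewrite -(fsbig_widen `I_q.+1) -?fsbig_ord // => j [_ /= /negP].
rewrite -leqNgt => qj; have [_ _ _ _ ->//] := Vlevel.
by rewrite scaler0.
Qed.

Lemma MT_IE (m k : int) (v : V) :
  MT_I act d m k v = single (m + k) (Ipoly (act := act) h (dres d m) m%:~R v).
Proof.
have [_ _ _ I0 _] := Vlevel.
rewrite /MT_I /Ipoly; congr (single _ _).
rewrite -(fsbig_widen `I_h.+1) -?fsbig_ord // => [|j [_ /= /negP]]; last first.
  by rewrite -leqNgt => hj; rewrite I0 ?scaler0 // (leq_trans hj) ?leq_addr.
(* For entry 1 the two sums are offset by one: the last term on the left contains I_(h+1) = 0, and
   the first on the right is cut off. *)
have := dres_le1 d m p0; case: (dres d m) => [|[|//]] _.
  by apply: eq_bigr => j _; rewrite mul1r addn0.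
rewrite big_ord_recr [in RHS]big_ord_recl /= mul0r scale0r add0r.
rewrite addn1 I0 // scaler0 addr0; apply: eq_bigr => j _.
by rewrite addn1 mul1r.
Qed.

Lemma MT_basis_0 (b : Tbasis) (k : int) : MT_basis act a d b k 0 = 0.
Proof.
case: b => [m|m|||] //=; rewrite ?MT_LE ?MT_IE.
- rewrite /Lpoly scaler0 add0r big1 ?single0 // => j _.
  by rewrite (linear_map0 (act_TL_linear Vmod j)) scaler0.
(* Linearity of I_j is known only inside the subalgebra; below the cutoff the coefficient is zero
   instead. *)
- rewrite /Ipoly big1 ?single0 // => j _; have [mj|jm] := leqP (dres d m) j.
    by rewrite linear_map0 ?scaler0 //; apply: (act_TI_linear Vmod);
       rewrite (leq_trans _ mj) // mind_le_dres.
  by rewrite mul0r scale0r.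
Qed.

Lemma MT_Tgen (b : Tbasis) (f : MTspace V) :
  MT act a d (Tgen b) f = \sum_(k \in [set: int]) MT_basis act a d b k (f k).
Proof.
rewrite /MT (@fsbig_only _ _ _ b) => [|b' b'b].
  by apply: eq_fsbigr => k _; rewrite singleE eqxx scale1r.
by apply: fsbig1 => k _; rewrite singleE (negbTE b'b) scale0r.
Qed.

Lemma MT_Tgen_single (b : Tbasis) (k : int) (v : V) :
  MT act a d (Tgen b) (single k v) = MT_basis act a d b k v.
Proof.
rewrite MT_Tgen (@fsbig_only _ _ _ k) => [|k' k'k]; first by rewrite singleE eqxx.
by rewrite singleE (negbTE k'k) MT_basis_0.
Qed.

Lemma MT_TL0 (f : MTspace V) (k : int) :
  MT act a d (TL 0) f k = (a + k%:~R) *: f k.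
Proof.
pose F k := (a + k%:~R) *: f k.
suff {k} fin : (F : int -> V) \in @finsupp_pred _ int V.
  rewrite MT_Tgen -[RHS]/(FinSupp fin k); congr (finsupp_fun _ k).
  rewrite -(@fsum_single _ _ _ F (FinSupp fin)) //; apply: eq_fsbigr => k' _.
  rewrite /= MT_LE add0r /Lpoly big1 ?addr0 // => j _.
  by rewrite exprS mulr0z !mul0r scale0r.
apply/asboolP; apply: sub_finite_set (fin_supp_finite f) => k' /=.
by apply: contra => /eqP fk0; rewrite /F fk0 scaler0.
Qed.

(** The product of L_0 - (a + i) over the degrees i other than k in the support of [f] kills all
    components but the one of degree k, which it multiplies by the nonzero product of the k - i. *)
Lemma submodule_single (W : set (MTspace V)) (f : MTspace V) (k : int) :
  submodule [set: THV R] (MT act a d) W -> W f -> W (single k (f k)).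
Proof.
move=> [subW WT] Wf.
pose s := [seq j <- fset_set [set j | f j != 0] | j != k].
pose c (s : seq int) (j : int) : R[i] := \prod_(i <- s) (j%:~R - i%:~R).
have [g Wg gE] : exists2 g, W g & forall j, g j = c s j *: f j.
  elim: s => [|i s [g Wg gE]].
    by exists f => // j; rewrite /c big_nil scale1r.
  exists (MT act a d (TL 0) g - (a + i%:~R) *: g).
    apply: (subspaceB subW); first by apply: WT.
    exact: (subspaceZ subW).
  move=> j; rewrite -[LHS]/(MT act a d (TL 0) g j - (a + i%:~R) *: g j).
  rewrite MT_TL0 -scalerBl gE scalerA /c big_cons.
  by congr (_ * _ *: _); rewrite opprD addrACA subrr add0r.
have ck : c s k != 0.
  rewrite /c prodf_seq_neq0; apply/allP => j.
  by rewrite mem_filter => /andP[jk _]; rewrite subr_eq0 eqr_int eq_sym.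
suff -> : single k (f k) = (c s k)^-1 *: g by apply: (subspaceZ subW).
apply: finsuppP => j; rewrite finsuppZE gE singleE.
case: eqVneq => [->|jk]; first by rewrite scalerA mulVf // scale1r.
have [->|fj] := eqVneq (f j) 0; first by rewrite !scaler0.
suff -> : c s j = 0 by rewrite scale0r scaler0.
apply/eqP; rewrite /c prodf_seq_eq0; apply/hasP; exists j; last by rewrite subrr eqxx.
by rewrite mem_filter jk in_fset_set ?inE //; exact: fin_supp_finite.
Qed.

Lemma MT_submodule_full (W : set (MTspace V)) (f : MTspace V) :
  irreducible (Tsub (mind d)) act ->
  submodule [set: THV R] (MT act a d) W -> W f -> f <> 0 -> W = [set: MTspace V].
Proof.
move=> irr subW Wf f0.
have [k fk0] : exists k, f k <> 0.
  by apply: contra_notP f0 => /forallNP f0; apply: finsuppP => k; apply: contrapT.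
(* These are the graded components of [W], viewed inside V. *)
pose Wk k := [set v : V | W (single k v)].
have full s v : Wk s v.
  apply: (graded_full p0 Vmod Vlevel (W := Wk) (a := a)) fk0 s v => //.
  - move=> j; split; first by rewrite /Wk /= single0; exact: subW.1.1.
    by move=> c u v Wu Wv; rewrite /Wk /= single_linear; apply: subW.1.2.
  - by move=> m j v Wv; rewrite /Wk /= -MT_LE
       -[MT_L _ _ _ _ _]/(MT_basis act a d (bL m) j v) -MT_Tgen_single;
     apply: subW.2.
  - by move=> m j v Wv; rewrite /Wk /= -MT_IE
       -[MT_I _ _ _ _ _]/(MT_basis act a d (bI m) j v) -MT_Tgen_single;
     apply: subW.2.
  - exact: submodule_single.
apply/seteqP; split=> // g _; rewrite -(@fsum_single _ _ _ g g) //.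
by apply: (subspace_sum subW.1) => j _; exact: full.
Qed.

(** This set is U tensored with the Laurent polynomials; it transfers irreducibility from the loop
    module down to V. *)
Lemma loop_submodule (U : set V) : submodule (Tsub (mind d)) act U ->
  submodule [set: THV R] (MT act a d) [set f : MTspace V | forall k, U (f k)].
Proof.
move=> [subU UT]; set UM : set (MTspace V) := (X in submodule _ _ X).
have subUM : subspace UM.
  split=> [k|c f g Uf Ug k]; first exact: subU.1.
  exact: (subU.2 c _ _ (Uf k) (Ug k)).
split=> // x f _ Uf; apply: (subspace_sum subUM) => b _.
apply: (subspace_sum subUM) => k _; apply: (subspaceZ subUM).
suff [m [v Uv ->]] : exists m, exists2 v, U v & MT_basis act a d b k (f k) = single m v.
  by move=> j; rewrite singleE; case: ifP => _ //; exact: subU.1.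
case: b => [m|m|||] /=; try by exists 0, 0; rewrite ?single0 //; exact: subU.1.
- rewrite MT_LE; eexists; eexists; last by [].
  apply: (subspaceD subU); first exact: (subspaceZ subU).
  apply: (subspace_sum subU) => j _; apply: (subspaceZ subU); apply: UT => //.
  exact: Tsub_TL.
rewrite MT_IE; eexists; eexists; last by [].
apply: (subspace_sum subU) => j _; have [mj|jm] := leqP (dres d m) j.
  apply: (subspaceZ subU); apply: UT => //; apply: Tsub_TI.
  by rewrite (leq_trans _ mj) // mind_le_dres.
by rewrite mul0r scale0r; exact: subU.1.
Qed.

End LoopModuleSubmodules.

(** * The equivalence of the two irreducibilities *)

Theorem theorem3p4 (R : realType) (p : nat) (hp : (1 < p)%N) (a : R[i])
    (h q : nat) (d : {ffun 'I_p -> 'I_2}) (V : lmodType R[i])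
    (act : THV R -> V -> V)
    (Vmod : is_module (Tsub (mind d)) act)
    (Vlevel : annihilating_level (mind d) act h q) :
  irreducible [set: THV R] (MT act a d) <-> irreducible (Tsub (mind d)) act.
Proof.
have p0 : (0 < p)%N := ltnW hp.
split=> [[[f f0] irr]|irr].
  split=> [|U subU].
    apply: contra_notP f0 => /forallNP V0; apply: finsuppP => k.
    exact: contrapT (V0 _).
  (* [U] is recovered from its loop submodule through the elements u(0). *)
  have [U0|UT] := irr _ (loop_submodule p0 a Vlevel subU).
    left; apply/seteqP; split=> [u Uu|_ ->]; last exact: subU.1.1.
    have : [set f : MTspace V | forall k, U (f k)] (single 0 u).
      by move=> k; rewrite singleE; case: ifP => _ //; exact: subU.1.1.
    by rewrite U0 => /(congr1 (fun f : MTspace V => f 0)).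
  right; apply/seteqP; split=> // u _.
  have : [set: MTspace V] (single 0 u) by [].
  by rewrite -UT => /(_ 0).
split=> [|W subW].
  have [v v0] := irr.1; exists (single 0 v).
  by move=> /(congr1 (fun f : MTspace V => f 0)).
have [[f Wf f0]|W0] := pselect (exists2 f, W f & f <> 0).
  by right; exact: (MT_submodule_full p0 Vmod Vlevel irr subW Wf f0).
left; apply/seteqP; split=> [f Wf|_ ->]; last exact: subW.1.1.
by apply: contrapT => f0; apply: W0; exists f.
Qed.
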